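(* Let $C\ge 0$ and consider a linear estimator $\hat L_k=\sum_{i=1}^n k(x_i,d_i)Y_i$ whose weights satisfy $$\sum_{i=1}^n d_i k(x_i,d_i)=1\quad\text{and}\quad \sum_{i=1}^n(1-d_i)k(x_i,d_i)=-1.$$ Then the worst-case bias $\overline{\mathrm{bias}}_{\mathcal F_{\mathrm{Lip}}(C)}(\hat L_k)$ equals $$\max_{f\in\mathbb R^{2n}}\Big\{\sum_{i=1}^n k(x_i,d_i)f(x_i,d_i)-\frac1n\sum_{i=1}^n[f(x_i,1)-f(x_i,0)]\Big\}$$ subject to the constraints $$f(x_i,d)-f(x_j,d)\le C\|x_i-x_j\|_{\mathcal X},\qquad d\in\{0,1\},\ i,j\in\{1,\dots,n\},\qquad(\ast)$$ where $f\in\mathbb R^{2n}$ is identified with the vector $(f(x_1,0),\dots,f(x_n,0),f(x_1,1),\dots,f(x_n,1))'$. Furthermore, if $k(x_i,d_i)\ge 1/n$ whenever $d_i=1$ and $k(x_i,d_i)\le -1/n$ whenever $d_i=0$, then it suffices to impose $(\ast)$ (for both $d\in\{0,1\}$) only for those $i,j\in\{1,\dots,n\}$ with $d_i=1$, $d_j=0$ such that either $k(x_i,1)>1/n$ or $k(x_j,0)<-1/n$; that is, the maximum of the displayed objective subject only to these constraints is still equal to $\overline{\mathrm{bias}}_{\mathcal F_{\mathrm{Lip}}(C)}(\hat L_k)$.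
   Context: Fixed design regression model: $x_i\in\mathbb R^p$ and $d_i\in\{0,1\}$, $i=1,\dots,n$, are nonrandom, and $Y_i=f(x_i,d_i)+u_i$ with $u_1,\dots,u_n$ mutually independent, $E(u_i)=0$. $\|\cdot\|_{\mathcal X}$ is a norm on $\mathbb R^p$. The Lipschitz class is $$\mathcal F_{\mathrm{Lip}}(C)=\{f:\mathbb R^p\times\{0,1\}\to\mathbb R:\ |f(x,d)-f(\tilde x,d)|\le C\|x-\tilde x\|_{\mathcal X}\ \text{for all }x,\tilde x,\ d\in\{0,1\}\}.$$ The parameter of interest is $Lf=\frac1n\sum_{i=1}^n[f(x_i,1)-f(x_i,0)]$. The weights $k(x_i,d_i)$ are nonrandom real numbers (they may depend on all of $\{x_i,d_i\}_{i=1}^n$). The worst-case bias over a function class $\mathcal F$ is $$\overline{\mathrm{bias}}_{\mathcal F}(\hat L_k)=\sup_{f\in\mathcal F}E_f(\hat L_k-Lf)=\sup_{f\in\mathcal F}\Big[\sum_{i=1}^n k(x_i,d_i)f(x_i,d_i)-Lf\Big].$$ In the finite-dimensional program, coordinates of $f\in\mathbb R^{2n}$ are indexed by pairs $(i,d)$ and written $f(x_i,d)$. *)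

(* Defs.v *)
From HB Require Import structures.
From mathcomp Require Import all_boot all_order all_algebra.
From mathcomp Require Import all_classical all_reals all_analysis.

Set Implicit Arguments.
Unset Strict Implicit.
Unset Printing Implicit Defensive.

Import Order.TTheory GRing.Theory Num.Theory.
Local Open Scope classical_set_scope.
Local Open Scope ring_scope.

Definition is_norm (R : realType) (p : nat) (N : 'rV[R]_p -> R) : Prop :=
  [/\ forall v w, N (v + w) <= N v + N w,
      forall (a : R) v, N (a *: v) = `|a| * N v
    & forall v, N v = 0 -> v = 0].

Definition mutually_independent (disp : measure_display)
    (T : measurableType disp) (R : realType) (P : probability T R) (n : nat)
    (X : 'I_n -> {RV P >-> R}) : Prop :=
  forall (J : {set 'I_n}) (A : 'I_n -> set R),
    (forall i, measurable (A i)) ->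
    P (\bigcap_(i in [set` J]) (X i @^-1` A i)) =
      (\prod_(i in J) P (X i @^-1` A i))%E.

(* A treatment status in {0, 1} is a boolean. *)

Definition F_Lip (R : realType) (p : nat) (N : 'rV[R]_p -> R) (C : R) :
    set ('rV[R]_p -> bool -> R) :=
  [set f | forall x x' t, `|f x t - f x' t| <= C * N (x - x')].

Section Model.
Variables (R : realType) (p n : nat) (x : 'I_n -> 'rV[R]_p) (d : 'I_n -> bool).

Definition average_effect (f : 'rV[R]_p -> bool -> R) : R :=
  n%:R^-1 * \sum_(i < n) (f (x i) true - f (x i) false).

Variables (disp : measure_display) (T : measurableType disp).
Variable P : probability T R.
Variable u : 'I_n -> {RV P >-> R}.
Variable k : 'rV[R]_p -> bool -> R.

Definition outcome (f : 'rV[R]_p -> bool -> R) (i : 'I_n) (w : T) : R :=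
  f (x i) (d i) + u i w.

Definition linear_estimator (Y : 'I_n -> T -> R) (w : T) : R :=
  \sum_(i < n) k (x i) (d i) * Y i w.

Definition worst_case_bias (F : set ('rV[R]_p -> bool -> R)) : \bar R :=
  ereal_sup
    [set 'E_P[(fun w : T =>
                 (linear_estimator (outcome f) w - average_effect f)%R)]%E
    | f in F].

End Model.

Section Program.
Variables (R : realType) (p n : nat) (x : 'I_n -> 'rV[R]_p) (d : 'I_n -> bool).

(* A vector f of R^(2n) is a finite function on pairs: f (i, t) stands for
   the coordinate written f(x_i, t), even when the x_i are not distinct. *)

Definition objective (k : 'rV[R]_p -> bool -> R)
    (f : {ffun 'I_n * bool -> R}) : R :=
  \sum_(i < n) k (x i) (d i) * f (i, d i)
  - n%:R^-1 * \sum_(i < n) (f (i, true) - f (i, false)).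

Variables (N : 'rV[R]_p -> R) (C : R).

Definition feasible_for (S : 'I_n -> 'I_n -> Prop) :
    set {ffun 'I_n * bool -> R} :=
  [set f | forall (t : bool) (i j : 'I_n), S i j ->
     f (i, t) - f (j, t) <= C * N (x i - x j)].

Definition all_pairs (i j : 'I_n) : Prop := True.

Definition reduced_pairs (k : 'rV[R]_p -> bool -> R) (i j : 'I_n) : Prop :=
  [/\ d i = true, d j = false
    & n%:R^-1 < k (x i) true \/ k (x j) false < - n%:R^-1].

End Program.

Definition is_maximum (R : realType) (A : set (\bar R)) (m : \bar R) : Prop :=
  A m /\ ubound A m.

(* Main.v *)
Require Import Defs.
From HB Require Import structures.
From mathcomp Require Import all_boot all_order all_algebra.
From mathcomp Require Import all_classical all_reals all_analysis.
From mathcomp Require Import lra.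

Set Implicit Arguments.
Unset Strict Implicit.
Unset Printing Implicit Defensive.

Import Order.TTheory GRing.Theory Num.Theory.
Import numFieldNormedType.Exports.
Local Open Scope classical_set_scope.
Local Open Scope ring_scope.

(* Since the errors have mean zero, the expected error at f depends only on the
   values of f at the design points.  It splits into one linear form for each
   treatment status t, whose coefficients sum to zero; fixing the value at one
   point therefore makes the feasible set compact, and a maximum exists.  A
   feasible vector extends to a Lipschitz function by McShane's formula
   min_j (h_j + C |v - x_j|), so the two suprema agree.  Under the sign
   conditions the linear form for t = 1 is nonpositive on the untreated units and
   nonnegative on the treated ones (conversely for t = 0).  Taking the minimum in
   McShane's formula over one group only turns a vector satisfying the reduced
   constraints into a fully feasible one with an objective at least as large. *)

Section IsNorm.
Variables (R : realType) (p : nat) (N : 'rV[R]_p -> R).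
Hypothesis hN : is_norm N.

Lemma is_norm0 : N 0 = 0.
Proof. by case: hN => _ NZ _; rewrite -(scale0r 0) NZ normr0 mul0r. Qed.

Lemma is_normN v : N (- v) = N v.
Proof. by case: hN => _ NZ _; rewrite -scaleN1r NZ normrN1 mul1r. Qed.

Lemma is_normB v w : N (v - w) = N (w - v).
Proof. by rewrite -opprB is_normN. Qed.

Lemma is_norm_ge0 v : 0 <= N v.
Proof.
case: hN => ND _ _; have := ND v (- v).
by rewrite subrr is_norm0 is_normN; lra.
Qed.

Lemma is_norm_dist v w z : N (v - z) <= N (v - w) + N (w - z).
Proof. by case: hN => ND _ _; have := ND (v - w) (w - z); rewrite subrKA. Qed.

End IsNorm.

(** The minimum runs over [J] alone, so the lower bound at [i] asks only for constraints from [i] to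
    [J]; [h] may violate those inside [J]. This is what later lets the reduced program suffice. *)
Lemma mcshane_extension (R : realType) (T : Type) (D : T -> T -> R)
    (I : finType) (x : I -> T) (J : {pred I}) (h : I -> R) :
    (forall t, D t t = 0) -> (forall r s t, D r t <= D r s + D s t) ->
    (exists j, j \in J) ->
  exists g : T -> R,
    [/\ forall s t, g s - g t <= D s t,
        forall j, j \in J -> g (x j) <= h j
      & forall i, (forall j, j \in J -> h i - h j <= D (x i) (x j)) ->
          h i <= g (x i)].
Proof.
move=> D0 Dtri [j0 Jj0].
pose a t := [arg min_(j < j0 | j \in J) (h j + D t (x j))]%O.
have aP t : a t \in J /\
    forall j, j \in J -> h (a t) + D t (x (a t)) <= h j + D t (x j).
  by rewrite /a; case: arg_minP.
exists (fun t => h (a t) + D t (x (a t))); split=> [s t|j Jj|i hi].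
- have [_ /(_ _ (aP t).1)] := aP s.
  by have := Dtri s t (x (a t)); lra.
- by have [_ /(_ _ Jj)] := aP (x j); rewrite D0; lra.
- by have := hi _ (aP (x i)).1; lra.
Qed.

Lemma lipschitz_maximizer (R : realType) (n : nat) (D : 'I_n -> 'I_n -> R)
    (w : 'I_n -> R) (i0 : 'I_n) :
    (forall i j, 0 <= D i j) -> \sum_i w i = 0 ->
  exists2 g : 'I_n -> R, (forall i j, g i - g j <= D i j) &
    forall h : 'I_n -> R, (forall i j, h i - h j <= D i j) ->
      \sum_i w i * h i <= \sum_i w i * g i.
Proof.
move=> D0 w0.
(* The box holds the bounds that the constraints against [i0] impose on a vector vanishing at
   [i0]. *)
pose A := [set v : 'rV[R]_n | forall i, v ord0 i \in `[- D i0 i, D i i0]] `&`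
  \bigcap_(c in [set: 'I_n * 'I_n])
    [set v | v ord0 c.1 - v ord0 c.2 <= D c.1 c.2].
have A0 : A !=set0.
  exists 0; split=> [i|c _] /=; last by rewrite !mxE subrr D0.
  by rewrite !mxE in_itv/= oppr_le0 !D0.
have cA : compact A.
  apply: compact_closedI.
    by apply: (@rV_compact _ n (fun i => [set` `[- D i0 i, D i i0]])) => i;
      exact: segment_compact.
  apply: closed_bigI => c _.
  apply: (@preimage_closed _ _ (fun v : 'rV[R]_n => v ord0 c.1 - v ord0 c.2)
    [set r | r <= D c.1 c.2]); last exact: closed_le.
  by move=> v _; apply: continuousB; exact: coord_continuous.
have cf : continuous (fun v : 'rV[R]_n => \sum_i w i * v ord0 i).
  apply: continuous_big => //; first exact: add_continuous.
  by move=> i _ v; apply: continuousM; [exact: cst_continuous|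
    exact: coord_continuous].
have [g] := compact_EVT_max A0 cA (continuous_subspaceT cf).
rewrite inE => -[_ gL] gmax.
exists (g ord0) => [i j|h hL]; first exact: (gL (i, j) I).
(* Subtracting [h i0] keeps the sum, as the weights sum to zero, and moves [h] into the box. *)
have -> : \sum_i w i * h i = \sum_i w i * (\row_i (h i - h i0)) ord0 i.
  under [RHS]eq_bigr do rewrite mxE mulrBr.
  by rewrite sumrB -mulr_suml w0 mul0r subr0.
apply: gmax; rewrite inE; split=> [i|[i j] _] /=; rewrite !mxE.
  by rewrite in_itv/= hL andbT lerNl opprB hL.
by have := hL i j; lra.
Qed.

(* The extension from J is at most h on J, where w <= 0, and at least h
   wherever w > 0, so only the constraints from {w > 0} to J matter. *)
Lemma lipschitz_dominating (R : realType) (I : finType) (D : I -> I -> R)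
    (J : {pred I}) (w h : I -> R) :
    (forall i, D i i = 0) -> (forall i j l, D i l <= D i j + D j l) ->
    (exists j, j \in J) ->
    (forall j, j \in J -> w j <= 0) -> (forall i, i \notin J -> 0 <= w i) ->
    (forall i j, i \notin J -> j \in J -> 0 < w i -> h i - h j <= D i j) ->
  exists2 g : I -> R, (forall i j, g i - g j <= D i j) &
    \sum_i w i * h i <= \sum_i w i * g i.
Proof.
move=> D0 Dtri J0 wJ wNJ hL.
have [g [gL gJ gNJ]] := mcshane_extension id h D0 Dtri J0.
exists g => //; apply: ler_sum => i _.
have [Ji|NJi] := boolP (i \in J).
  by rewrite ler_wnM2l ?wJ ?gJ.
(* A zero weight makes both terms vanish, so the constraints are called upon only where [w i] is
   positive. *)
have := wNJ _ NJi; rewrite le_eqVlt => /predU1P[<-|wi]; first by rewrite !mul0r.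
by rewrite ler_pM2l// gNJ// => j Jj; exact: hL.
Qed.

Section Bias.
Variables (R : realType) (p n : nat) (x : 'I_n -> 'rV[R]_p) (d : 'I_n -> bool).
Variable k : 'rV[R]_p -> bool -> R.

(* The coefficient of f(x_i, t) in the objective. *)
Definition bias_weight (t : bool) (i : 'I_n) : R :=
  (d i == t)%:R * k (x i) (d i) - (-1) ^+ (~~ t) * n%:R^-1.

Lemma objectiveE (f : {ffun 'I_n * bool -> R}) :
  objective x d k f = \sum_i bias_weight true i * f (i, true)
                    + \sum_i bias_weight false i * f (i, false).
Proof.
rewrite /objective mulr_sumr -sumrB -big_split; apply: eq_bigr => i _ /=.
by rewrite /bias_weight/=; case: (d i) => /=; lra.
Qed.

(** Within each arm the weights of the estimator and the coefficients of the average effect have the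
    same total, 1 or -1, and cancel. *)
Lemma sum_bias_weight (t : bool) : (0 < n)%N ->
  \sum_i (d i)%:R * k (x i) (d i) = 1 ->
  \sum_i (1 - (d i)%:R) * k (x i) (d i) = -1 ->
  \sum_i bias_weight t i = 0.
Proof.
move=> n0 hk1 hk0.
rewrite sumrB sumr_const card_ord -[X in _ - X]mulr_natr mulfVK ?pnatr_eq0 -?lt0n//.
case: t => /=; rewrite ?expr0 ?expr1; apply/eqP; rewrite subr_eq0; apply/eqP.
  by rewrite -[RHS]hk1; apply: eq_bigr => i _; case: (d i).
by rewrite -[RHS]hk0; apply: eq_bigr => i _; case: (d i); rewrite ?subrr ?subr0.
Qed.

Lemma expected_error (disp : measure_display) (T : measurableType disp)
    (P : probability T R) (u : 'I_n -> {RV P >-> R})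
    (f : 'rV[R]_p -> bool -> R) :
    (forall i, P.-integrable setT (EFin \o u i)) ->
    (forall i, 'E_P[u i] = 0)%E ->
  'E_P[(fun w => (linear_estimator x d k (outcome x d u f) w
                  - average_effect x f)%R)]%E
  = (objective x d k [ffun c => f (x c.1) c.2])%:E.
Proof.
move=> iu u0; set b := objective _ _ _ _.
have -> : (fun w => linear_estimator x d k (outcome x d u f) w
             - average_effect x f)
        = cst b \+ (fun w => \sum_i k (x i) (d i) * u i w).
  apply/funext => w /=.
  rewrite /b /objective /linear_estimator /outcome /average_effect.
  under [in LHS]eq_bigr do rewrite mulrDr.
  rewrite big_split/= addrAC; congr (_ - _ + _).
    by apply: eq_bigr => i _; rewrite ffunE.
  by congr (_ * _); apply: eq_bigr => i _; rewrite !ffunE.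
have iku i : P.-integrable setT (fun w => (k (x i) (d i))%:E * (u i w)%:E)%E.
  exact: integrableZl (iu i).
rewrite unlock integralD_EFin//=.
- rewrite integral_cst//= probability_setT mule1.
  under eq_integral do rewrite -sumEFin.
  under eq_integral do under eq_bigr do rewrite EFinM.
  rewrite integral_sum// big1 ?adde0// => i _.
  rewrite integralZl//; last exact: iu.
  by have := u0 i; rewrite unlock => ->; rewrite mule0.
- exact: finite_measure_integrable_cst.
- apply: (eq_integrable _ (fun w => \sum_i (k (x i) (d i))%:E * (u i w)%:E)%E) => //.
    by move=> w _ /=; rewrite -sumEFin; apply: eq_bigr => i _; rewrite EFinM.
  exact: integrable_sum.
Qed.

End Bias.

Theorem theorem2p1 (R : realType) (p n : nat)
    (N : 'rV[R]_p -> R) (hN : is_norm N)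
    (x : 'I_n -> 'rV[R]_p) (d : 'I_n -> bool)
    (disp : measure_display) (T : measurableType disp) (P : probability T R)
    (u : 'I_n -> {RV P >-> R})
    (hindep : mutually_independent u)
    (hint : forall i, P.-integrable setT (EFin \o u i))
    (hmean : forall i, ('E_P[u i] = 0)%E)
    (C : R) (hC : 0 <= C)
    (k : 'rV[R]_p -> bool -> R)
    (hk1 : \sum_(i < n) (d i)%:R * k (x i) (d i) = 1)
    (hk0 : \sum_(i < n) (1 - (d i)%:R) * k (x i) (d i) = -1) :
  is_maximum
    [set (objective x d k f)%:E | f in feasible_for x N C (@all_pairs n)]
    (worst_case_bias x d u k (F_Lip N C))
  /\
  ((forall i, d i = true -> n%:R^-1 <= k (x i) (d i)) ->
   (forall i, d i = false -> k (x i) (d i) <= - n%:R^-1) ->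
   is_maximum
     [set (objective x d k f)%:E
     | f in feasible_for x N C (reduced_pairs x d k)]
     (worst_case_bias x d u k (F_Lip N C))).
Proof.
(* For [n = 0] the empty sum in [hk1] would equal 1. *)
have n0 : (0 < n)%N.
  case: n x d u hindep hint hmean hk1 hk0 => // x' d' u' _ _ _.
  by rewrite big_ord0 => /esym/eqP; rewrite oner_eq0.
have w0 t := sum_bias_weight t n0 hk1 hk0.
pose DV v v' := C * N (v - v').
have DV0 v : DV v v = 0 by rewrite /DV subrr is_norm0 ?mulr0.
have DVtri v v' v'' : DV v v'' <= DV v v' + DV v' v''.
  by rewrite /DV -mulrDr ler_wpM2l// is_norm_dist.
have DVC v v' : DV v v' = DV v' v by rewrite /DV is_normB.
pose D i j := DV (x i) (x j).
have D_ge0 i j : 0 <= D i j by rewrite mulr_ge0// is_norm_ge0.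
(* No constraint links the two treatment statuses, so each is maximised separately. *)
have [g gL gmax] : exists2 g : bool -> 'I_n -> R,
    forall t i j, g t i - g t j <= D i j &
    forall t (h : 'I_n -> R), (forall i j, h i - h j <= D i j) ->
      \sum_i bias_weight x d k t i * h i
        <= \sum_i bias_weight x d k t i * g t i.
  have [g1 g1L g1max] := lipschitz_maximizer (Ordinal n0) D_ge0 (w0 true).
  have [g0 g0L g0max] := lipschitz_maximizer (Ordinal n0) D_ge0 (w0 false).
  by exists (fun t => if t then g1 else g0) => -[].
pose gv : {ffun 'I_n * bool -> R} := [ffun c => g c.2 c.1].
have gv_max (h : {ffun 'I_n * bool -> R}) :
    feasible_for x N C (@all_pairs n) h ->
    objective x d k h <= objective x d k gv.
  move=> hL; rewrite !objectiveE.
  under [X in _ <= X + _]eq_bigr do rewrite ffunE.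
  under [X in _ <= _ + X]eq_bigr do rewrite ffunE.
  by apply: lerD; apply: gmax => i j; exact: hL.
have gv_feasible S : feasible_for x N C S gv.
  by move=> t i j _; rewrite !ffunE; exact: gL.
have biasE : worst_case_bias x d u k (F_Lip N C) = (objective x d k gv)%:E.
  apply/le_anti/andP; split.
    apply: ge_ereal_sup => _ [f fL <-].
    rewrite expected_error// lee_fin gv_max// => t i j _; rewrite !ffunE/=.
    exact: le_trans (ler_norm _) (fL _ _ _).
  apply: ereal_sup_ubound.
  (* With all design points in [J], the upper and lower bounds of the extension coincide, so it
     interpolates [g t]. Repeated design points cause no conflict: [D] vanishes between them, which
     forces equal values. *)
  have /choice[F FP] t : exists f : 'rV[R]_p -> R,
      (forall v v', f v - f v' <= DV v v') /\ forall i, f (x i) = g t i.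
    have [|f [fL fle fge]] :=
        mcshane_extension x (J := predT) (g t) DV0 DVtri.
      by exists (Ordinal n0).
    exists f; split=> // i; apply/le_anti; rewrite fle//= fge// => j _;
      exact: gL.
  exists (fun v t => F t v).
    move=> v v' t; have [FL _] := FP t.
    by rewrite ler_norml lerNl opprB FL [_ * _]DVC FL.
  rewrite expected_error//; congr (objective _ _ _ _)%:E.
  by apply/ffunP => -[i t]; rewrite !ffunE (FP t).2.
rewrite biasE; split.
  by split; [exists gv|move=> _ [h hL <-]; rewrite lee_fin gv_max].
(* The same [gv] is feasible here; it remains to bound by it every [h] satisfying the reduced
   constraints. *)
move=> k1 k0; split; first by exists gv.
move=> _ [h hL <-]; rewrite lee_fin !objectiveE.
under [X in _ <= X + _]eq_bigr do rewrite ffunE.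
under [X in _ <= _ + X]eq_bigr do rewrite ffunE.
(* The weight totals 1 and -1 rule out an empty arm, so either group can serve as [J]. *)
have [i1 di1] : exists i, d i.
  apply: contrapT => nd; move: hk1; rewrite big1 => [/esym/eqP|i _].
    by rewrite oner_eq0.
  by case: (boolP (d i)) => [di|]; [case: nd; exists i|rewrite mul0r].
have [i0 di0] : exists i, ~~ d i.
  apply: contrapT => nd; move: hk0; rewrite big1 => [/esym/eqP|i _].
    by rewrite oppr_eq0 oner_eq0.
  by case: (boolP (d i)) => [|di]; [rewrite subrr mul0r|case: nd; exists i].
have D0 i : D i i = 0 by exact: DV0.
have Dtri i j l : D i l <= D i j + D j l by exact: DVtri.
(* The coefficient is [-1/n] on untreated units and [k - 1/n] on treated ones, hence positive
   exactly at the treated units whose reduced constraints are imposed against all untreated ones. *)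
have side1 : \sum_i bias_weight x d k true i * h (i, true)
    <= \sum_i bias_weight x d k true i * g true i.
  have [|i /negPf di|i /negPn di|i j /negPn di /negPf dj wi|f fL hf]
    := lipschitz_dominating (J := [pred i | ~~ d i])
         (w := bias_weight x d k true) (h := fun i => h (i, true)) D0 Dtri.
  - by exists i0.
  - rewrite /bias_weight di/= mul0r sub0r expr0 mul1r oppr_le0 invr_ge0.
    exact: ler0n.
  - by have := k1 _ di; rewrite /bias_weight di/= mul1r expr0 mul1r subr_ge0.
  - apply: hL; split=> //; left; move: wi.
    by rewrite /bias_weight di/= mul1r expr0 mul1r subr_gt0.
  exact: le_trans hf (gmax true f fL).
(* Here the coefficient is [1/n] on treated units and [k + 1/n] on untreated ones. Negating weights
   and values keeps every product, gives the required signs with [J] the treated units, and turns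
   differences around to match the reduced constraints. *)
have side0 : \sum_i bias_weight x d k false i * h (i, false)
    <= \sum_i bias_weight x d k false i * g false i.
  have [|i|i|i j|f fL hf]
    := lipschitz_dominating (J := [pred i | d i])
         (w := fun i => - bias_weight x d k false i)
         (h := fun i => - h (i, false)) D0 Dtri.
  - by exists i1.
  - rewrite inE => di.
    rewrite /bias_weight di/= mul0r sub0r expr1 mulN1r opprK oppr_le0 invr_ge0.
    exact: ler0n.
  - rewrite inE => /negPf di; have := k0 _ di.
    by rewrite /bias_weight di/= mul1r expr1; lra.
  - rewrite !inE => /negPf di dj wi.
    have hji : h (j, false) - h (i, false) <= D j i.
      apply: hL; split=> //; right; move: wi.
      by rewrite /bias_weight di/= mul1r expr1; lra.
    by rewrite [D i j]DVC; move: hji; rewrite /D; lra.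
  have <- : \sum_i (- bias_weight x d k false i) * - h (i, false)
      = \sum_i bias_weight x d k false i * h (i, false).
    by apply: eq_bigr => i _; rewrite mulrNN.
  apply: le_trans hf _.
  have -> : \sum_i (- bias_weight x d k false i) * f i
      = \sum_i bias_weight x d k false i * - f i.
    by apply: eq_bigr => i _; rewrite mulNr mulrN.
  (* The vector [- f] is feasible because [D] is symmetric. *)
  apply: gmax => i j.
  by have := fL j i; rewrite [D j i]DVC /D; lra.
exact: lerD.
Qed.
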